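(* Let $p$ be a prime and let $2\leq q\leq p$. Suppose that $X$ is a nonempty paracompact free $\mathbb{Z}_p$-space with $n_q=\mathrm{ind}_q(X,\mathbb{Z}_p)<\infty$. Then \[n_q(q-1)+1\leq \mathrm{secat}(X\to X/\mathbb{Z}_p)\leq n_q(p-1)+q-1.\] Or equivalently: \[\mathrm{secat}(X\to X/\mathbb{Z}_p)=n_q(q-1)+1+j \quad\text{for some } j\in\{0,1,\ldots,\epsilon_{p,q}\},\] where $\epsilon_{p,q}=n_q(p-q)+q-2$.
   Context: ''Space'' means topological space and ''map'' means continuous map. For a finite group $G$, a free $G$-space is a Hausdorff space $X$ on which $G$ acts freely on the left; $X\to X/G$ denotes the quotient map (a fibration). $\mathbb{Z}_p$ is the cyclic group of order $p$. For a finite group $G$ of order $\ell$, $2\leq q\leq\ell$, and a space $Y$, the configuration-like space $F(Y,\ell,q)\subset Y^\ell$ (subspace topology) is the set of all $(y_1,\ldots,y_\ell)\in Y^\ell$ such that for any indices $0<i_1<\cdots<i_q\leq\ell$ at least two of $y_{i_1},\ldots,y_{i_q}$ are different. Fix an enumeration $G=\{g_1,\ldots,g_\ell\}$ and let $h:G\to\{1,\ldots,\ell\}$ be the bijection $h(g_j)=j$. The group $G$ acts on the left on $Y^\ell$ by $g(y_1,\ldots,y_\ell)=(y_{h(g^{-1}g_1)},\ldots,y_{h(g^{-1}g_\ell)})$, and this restricts to a left action on $F(Y,\ell,q)$. The $q$-th index $\mathrm{ind}_q(X,G)$ of a free $G$-space $X$ is the least integer $k\in\{0,1,2,\ldots\}$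 such that there exists a $G$-equivariant map $X\to F(\mathbb{R}^{k+1},\ell,q)$, and $\mathrm{ind}_q(X,G)=\infty$ if no such $k$ exists. For a fibration $\pi:E\to B$, the sectional category $\mathrm{secat}(\pi)$ is the minimal cardinality of an open cover of $B$ such that each element $U$ of the cover admits a local section of $\pi$ (a map $s:U\to E$ with $\pi\circ s$ equal to the inclusion $U\hookrightarrow B$); $\mathrm{secat}(\pi)=\infty$ if no such finite cover exists. *)

(* Defs.v *)
From HB Require Import structures.
From mathcomp Require Import all_boot all_order all_algebra all_fingroup.
From mathcomp Require Import all_classical all_reals all_analysis.

Set Implicit Arguments.
Unset Strict Implicit.
Unset Printing Implicit Defensive.

Import numFieldNormedType.Exports.

Local Open Scope classical_set_scope.
Local Open Scope quotient_scope.
Local Open Scope card_scope.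

(* The minimum of a set of naturals; None stands for infinity (empty set). *)
Definition least (P : set nat) : option nat :=
  match pselect (exists n, `[< P n >]) with
  | left exP => Some (ex_minn exP)
  | right _ => None
  end.

Lemma least_SomeP (P : set nat) n :
  least P = Some n <-> P n /\ forall m, P m -> (n <= m)%N.
Proof.
rewrite /least; case: pselect => [exP|nexP]; last first.
  by split=> // -[Pn _]; case: nexP; exists n; apply/asboolP.
case: ex_minnP => k /asboolP Pk k_min; split=> [[<-]|[Pn n_min]].
  by split=> // m Pm; apply: k_min; apply/asboolP.
congr Some; apply/eqP; rewrite eqn_leq n_min// andbT.
by apply: k_min; apply/asboolP.
Qed.

Lemma least_NoneP (P : set nat) : least P = None <-> P = set0.
Proof.
rewrite /least; case: pselect => [exP|nexP]; split=> //.
  by move=> P0; exfalso; case: exP => n /asboolP; rewrite P0.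
by move=> _; apply/seteqP; split=> // n Pn; apply: nexP; exists n; apply/asboolP.
Qed.

Section Actions.
Variable gT : finGroupType.

Record left_action (T : Type) := LeftAction {
  left_act :> gT -> T -> T;
  left_act1 : forall x, left_act 1%g x = x;
  left_actM : forall g h x, left_act (g * h)%g x = left_act g (left_act h x) }.

Definition free_Gspace (X : topologicalType) (a : left_action X) : Prop :=
  [/\ hausdorff_space X, (forall g, continuous (a g)) &
      forall g x, a g x = x -> g = 1%g].

Definition equivariant (S T : Type) (a : left_action S) (b : left_action T)
  (f : S -> T) : Prop := forall g x, f (a g x) = b g (f x).

Section Orbits.
Variables (X : topologicalType) (a : left_action X).

Definition orbit_rel : rel X := [rel x y | [exists g, a g x == y]].

Lemma orbit_rel_is_equiv : equiv_class_of orbit_rel.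
Proof.
split=> [x|x y|y x z] /=.
- by apply/existsP; exists 1%g; rewrite left_act1.
- by apply/idP/idP => /existsP[g /eqP <-]; apply/existsP; exists g^-1%g;
    rewrite -left_actM mulVg left_act1.
- move=> /existsP[g /eqP <-] /existsP[h /eqP <-].
  by apply/existsP; exists (h * g)%g; rewrite left_actM.
Qed.

Canonical orbit_equiv := EquivRelPack orbit_rel_is_equiv.

Definition orbit_space : topologicalType :=
  quotient_topology {eq_quot orbit_equiv}.

Definition orbit_map : X -> orbit_space := \pi_{eq_quot orbit_equiv}.

End Orbits.
End Actions.

(* G = {g_1, ..., g_l} with h = enum_idx, indexed from 0. *)
Record enumeration (gT : finGroupType) (l : nat) := Enumeration {
  enum_elt : 'I_l -> gT;
  enum_idx : gT -> 'I_l;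
  enum_eltK : cancel enum_elt enum_idx;
  enum_idxK : cancel enum_idx enum_elt }.

Section Configurations.
Variables (Y : topologicalType) (l q : nat).

(* F(Y, l, q) inside Y^l with the product topology; maps into conf use the
   subspace topology carried by set_type conf. *)
Definition conf : set {ptws 'I_l -> Y} :=
  [set y | forall i : 'I_q -> 'I_l, {homo i : r s / (r < s)%N} ->
     exists r s, y (i r) <> y (i s)].

(* Injective index families may be reordered into increasing ones. *)
Lemma conf_inj (y : {ptws 'I_l -> Y}) (i : 'I_q -> 'I_l) :
  conf y -> injective i -> exists r s, y (i r) <> y (i s).
Proof.
move=> Fy i_inj; pose S := [set i r | r in 'I_q]%SET.
have cS : #|S| = q by rewrite card_imset// card_ord.
have leS (r : 'I_q) : (r < #|S|)%N by rewrite cS.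
pose i' r : 'I_l := enum_val (Ordinal (leS r)).
have i'_incr : {homo i' : r s / (r < s)%N}.
  move=> r s rs; have x0 : 'I_l := i r.
  rewrite /i' !(enum_val_nth x0) /=.
  have lt_trans : transitive (fun j k : 'I_l => (j < k)%N).
    by move=> ? ? ?; apply: ltn_trans.
  have sorted_S : sorted (fun j k : 'I_l => (j < k)%N) (enum S).
    rewrite /enum_mem; apply: (sorted_filter lt_trans); rewrite -enumT.
    by have := iota_ltn_sorted 0 l; rewrite -val_enum_ord sorted_map.
  by apply: (sorted_ltn_nth lt_trans x0 sorted_S); rewrite ?inE -?cardE.
have [r [s yrs]] := Fy i' i'_incr.
have inS t : exists u, i' t = i u.
  by have /imsetP[u _ it] := enum_valP (Ordinal (leS t)); exists u.
by have [u ru] := inS r; have [v sv] := inS s; exists u, v; rewrite -ru -sv.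
Qed.

Variables (gT : finGroupType) (e : enumeration gT l).

Definition conf_act_fun (g : gT) (y : {ptws 'I_l -> Y}) : {ptws 'I_l -> Y} :=
  fun j => y (enum_idx e (g^-1 * enum_elt e j)%g).

Lemma conf_act_mem g (y : conf) : conf_act_fun g (set_val y) \in conf.
Proof.
apply/mem_set => i i_incr; rewrite /conf_act_fun.
apply: (conf_inj (i := fun r => enum_idx e (g^-1 * enum_elt e (i r))%g)).
  exact: set_valP.
have i_inj : injective i.
  move=> r s irs; apply: val_inj; case: (ltngtP r s) => // /i_incr;
  by rewrite irs ltnn.
move=> r s /(can_inj (enum_idxK e)) /mulgI /(can_inj (enum_eltK e)).
exact: i_inj.
Qed.

Definition conf_act (g : gT) (y : conf) : conf := SigSub (conf_act_mem g y).

Lemma conf_act1 y : conf_act 1%g y = y.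
Proof.
apply: val_inj; apply/funext => j /=.
by rewrite /conf_act_fun invg1 mul1g enum_eltK.
Qed.

Lemma conf_actM g h y : conf_act (g * h)%g y = conf_act g (conf_act h y).
Proof.
apply: val_inj; apply/funext => j /=.
by rewrite /conf_act_fun set_valE /= /conf_act_fun enum_idxK invMg mulgA.
Qed.

Definition conf_action : left_action gT conf := LeftAction conf_act1 conf_actM.

End Configurations.

Arguments conf : clear implicits.
Arguments conf_action Y {l} q {gT} e.

(* ind_q; R^(k+1) is 'rV[R]_k.+1. *)
Definition ind (R : realType) (gT : finGroupType) (l : nat)
    (e : enumeration gT l) (q : nat) (X : topologicalType)
    (a : left_action gT X) : option nat :=
  least [set k | exists f : X -> conf 'rV[R]_k.+1 l q,
    continuous f /\ equivariant a (conf_action 'rV[R]_k.+1 q e) f].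

Definition has_local_section (E B : topologicalType) (pi : E -> B)
    (U : set B) : Prop :=
  exists s : U -> E, continuous s /\ forall u : U, pi (s u) = set_val u.

Definition secat (E B : topologicalType) (pi : E -> B) : option nat :=
  least [set n | exists C : set (set B),
    [/\ C #= `I_n, C `<=` open, \bigcup_(U in C) U = [set: B] &
        C `<=` has_local_section pi]].

Definition locally_finite (X : topologicalType) (C : set (set X)) : Prop :=
  forall x : X, exists2 W, nbhs x W & finite_set [set V | C V /\ V `&` W !=set0].

(* The Hausdorff axiom is not included; free_Gspace provides it. *)
Definition paracompact (X : topologicalType) : Prop :=
  forall C : set (set X), C `<=` open -> \bigcup_(U in C) U = [set: X] ->
  exists D : set (set X),
    [/\ D `<=` open, \bigcup_(V in D) V = [set: X],
        (forall V, D V -> exists2 U, C U & V `<=` U) & locally_finite D].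

(* Main.v *)
Require Import Defs.
From HB Require Import structures.
From mathcomp Require Import all_boot all_order all_algebra all_fingroup.
From mathcomp Require Import all_classical all_reals all_analysis.

(**
  An equivariant map X -> F(Y, l, q) is the same thing as a map phi : X -> Y
  that does not take the same value at q distinct points of an orbit.  Local
  sections of X -> X/G over open sets correspond to open sets V of X ("slices")
  whose translates gV are pairwise disjoint.

  Upper bound.  Given phi : X -> R^(n+1), look at the first n coordinates: if one
  of them is not constant on the orbit of x, let B be the set of translates of x
  minimizing it, so 0 < #|B| < p; otherwise use the last coordinate, and then
  #|B| < q.  For each coordinate and each size k, the points of X having some
  k-subset B of their orbit on which the coordinate is strictly smaller than
  elsewhere form an open set, on which B is unique.  As p is prime and 0 < k < p,
  exactly one translate of B has zero sum in Z_p, and requiring B itself to have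
  zero sum cuts out a slice.  This gives n (p - 1) + (q - 1) slices.

  Lower bound.  Given s <= (k + 1)(q - 1) slices V_i whose translates cover X,
  take functions theta_i supported in V_i (X is normal) and distribute them over
  the k + 1 coordinates, q - 1 of them in each, the coordinate being the sum of
  theta_i(g^-1 x) h_i(g) over i and g.  For weights h_i in general position, q
  equal values of this coordinate in an orbit force these theta_i to vanish on it.
*)

Set Implicit Arguments.
Unset Strict Implicit.
Unset Printing Implicit Defensive.

Import Order.TTheory GRing.Theory Num.Theory.
Import numFieldNormedType.Exports.

Local Open Scope classical_set_scope.
Local Open Scope card_scope.
Local Open Scope ring_scope.

Lemma sum_digits_inj (b m : nat) (d d' : 'I_m -> nat) :
  (forall i, d i < b)%N -> (forall i, d' i < b)%N ->
  (\sum_i d i * b ^ i = \sum_i d' i * b ^ i)%N -> d =1 d'.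
Proof.
elim: m d d' => [|m IH] d d' db d'b; first by move=> _ [].
rewrite !big_ord_recl /= !expn0 !muln1.
under eq_bigr do rewrite /bump /= expnS mulnCA; rewrite -big_distrr /=.
under [in RHS]eq_bigr do rewrite /bump /= expnS mulnCA; rewrite -big_distrr /=.
move=> E; have b_gt0 : (0 < b)%N by apply: leq_ltn_trans (db ord0).
have E0 : d ord0 = d' ord0.
  have := congr1 (modn^~ b) E.
  by rewrite ![(_ + b * _)%N]addnC ![(b * _)%N]mulnC !modnMDl !modn_small.
move/eqP: E; rewrite E0 eqn_add2l eqn_pmul2l// => /eqP /IH E i.
case: (unliftP ord0 i) => [j ->|->//]; exact: E.
Qed.

Lemma exists_nonroot (R : numDomainType) (P : {poly R}) :
  P != 0 -> exists x, ~~ root P x.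
Proof.
move=> P0; pose rs : seq R := [seq k%:R | k <- iota 0 (size P)].
have rs_uniq : uniq rs.
  by rewrite map_inj_uniq ?iota_uniq// => i j /eqP; rewrite eqr_nat => /eqP.
have [/(max_poly_roots P0)/(_ rs_uniq)|] := boolP (all (root P) rs).
  by rewrite size_map size_iota ltnn.
by rewrite -has_predC => /hasP[x _ Px]; exists x.
Qed.

(* With h_j(g) = x ^ (rank g * #|gT| ^ j), the monomials of the determinant of the
   system are pairwise distinct powers of x by uniqueness of base #|gT| digits,
   so the determinant is a nonzero polynomial in x. *)
Lemma exists_generic (R : numFieldType) (gT : finGroupType) (m : nat) :
  exists h : 'I_m -> gT -> R,
  forall (u : 'I_m.+1 -> gT) (t : 'I_m -> gT) (c : 'I_m -> R) (b : R),
    injective u -> (forall r, \sum_j c j * h j (u r * t j)%g = b) ->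
    forall j, c j = 0.
Proof.
pose w (j : 'I_m) (g : gT) := (enum_rank g * #|gT| ^ j)%N.
pose E u (t : 'I_m -> gT) (i r : 'I_m.+1) :=
  if unlift ord0 i is Some j then w j (u r * t j)%g else 0.
pose M u t : 'M[{poly R}]_m.+1 := \matrix_(i, r) 'X^(E u t i r).
have det_neq0 u t : injective u -> \det (M u t) != 0.
  move=> u_inj.
  have detE : \det (M u t) =
      \sum_(s : 'S_m.+1) (-1) ^+ s * 'X^(\sum_i E u t i (s i)).
    apply: eq_bigr => s _; congr (_ * _); rewrite expr_sum.
    by apply: eq_bigr => i _; rewrite mxE.
  suff coef1 : (\det (M u t))`_(\sum_i E u t i i) = 1.
    by apply: contra_eq_neq coef1 => ->; rewrite coef0 eq_sym oner_eq0.
  rewrite detE coef_sum (bigD1 1%g)//= odd_perm1 expr0 mul1r coefXn.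
  under [X in (_ == X)]eq_bigr do rewrite perm1.
  rewrite eqxx big1 ?addr0// => s s1; rewrite mulr_sign.
  suff /negPf E_neq : (\sum_i E u t i i != \sum_i E u t i (s i))%N.
    by case: (s : bool); rewrite ?coefN coefXn E_neq ?oppr0.
  apply: contra s1; rewrite !big_ord_recl /E !unlift_none !add0n => /eqP.
  under eq_bigr do rewrite liftK; under [in RHS]eq_bigr do rewrite liftK.
  move/sum_digits_inj => /(_ (fun=> ltn_ord _) (fun=> ltn_ord _)) Es.
  have s_lift j : s (lift ord0 j) = lift ord0 j.
    by have /val_inj/enum_rank_inj/mulIg/u_inj := Es j.
  apply/eqP/permP => i; rewrite perm1.
  case: (unliftP ord0 i) => [j|] -> //.
  have [j|//] := unliftP ord0 (s ord0).
  by rewrite -s_lift => /perm_inj.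
pose P := \prod_(u : {ffun 'I_m.+1 -> gT} | injectiveb u)
  \prod_(t : {ffun 'I_m -> gT}) \det (M u t).
have /exists_nonroot[x Px] : P != 0.
  rewrite prodf_seq_neq0; apply/allP => u _; apply/implyP => /injectiveP u_inj.
  by rewrite prodf_seq_neq0; apply/allP => t _; apply/implyP => _; apply: det_neq0.
exists (fun j g => x ^+ w j g) => u t c b u_inj sum_b.
have det_x : \det (map_mx (horner_eval x) (M u t)) != 0.
  apply: contra Px; rewrite det_map_mx => det0.
  rewrite /root /P horner_prod.
  have fu_inj : injectiveb (finfun u).
    by apply/injectiveP => r r'; rewrite !ffunE => /u_inj.
  rewrite (bigD1 (finfun u))//= horner_prod (bigD1 (finfun t))//=.
  suff -> : M (finfun u) (finfun t) = M u t.
    by rewrite (eqP det0 : (\det (M u t)).[x] = 0) !mul0r.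
  apply/matrixP => i r; rewrite !mxE /E; case: unlift => // j.
  by rewrite !ffunE.
pose v : 'rV[R]_m.+1 :=
  \row_i if unlift ord0 i is Some j then c j else - b.
have [v0|v0] := eqVneq v 0.
  by move=> j; move/rowP/(_ (lift ord0 j)): v0; rewrite !mxE liftK.
case/negP: det_x; apply/det0P; exists v => //; apply/rowP => r.
rewrite !mxE big_ord_recl !mxE /E unlift_none /= /horner_eval expr0 hornerC mulr1.
rewrite -(sum_b r); under eq_bigr do rewrite !mxE /E !liftK hornerXn.
by rewrite addNr.
Qed.

Lemma paracompact_separation (X : topologicalType) (A B : set X) :
  paracompact X -> closed A ->
  (forall x, A x -> exists P, [/\ open P, P x & closure P `&` B = set0]) ->
  exists W, [/\ open W, A `<=` W & closure W `&` B = set0].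
Proof.
move=> pX clA sepA.
pose C := [set P : set X | open P /\ (closure P `&` B = set0 \/ P `<=` ~` A)].
have [|D [oD covD refD lfD]] := pX C (fun P CO => proj1 CO).
  apply/seteqP; split=> // x _; have [/sepA[P [oP Px PB]]|nAx] := pselect (A x).
    by exists P => //; split=> //; left.
  by exists (~` A) => //; split; [exact: closed_openC|right].
exists (\bigcup_(V in [set V | D V /\ V `&` A !=set0]) V); split.
- by apply: bigcup_open => V [/oD].
- move=> x Ax; have : (\bigcup_(V in D) V) x by rewrite covD.
  by move=> [V DV Vx]; exists V => //; split=> //; exists x.
apply/seteqP; split=> // b [clb Bb].
have [N Nb finN] := lfD b.
pose F := [set V | (D V /\ V `&` N !=set0) /\ V `&` A !=set0].
have finF : finite_set F by apply: sub_finite_set finN => V [].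
have clF : closed (\bigcup_(V in F) closure V).
  by apply: closed_bigcup => // V _; exact: closed_closure.
have nFb : (~` \bigcup_(V in F) closure V) b.
  move=> [V [[DV _] [x [Vx Ax]]] clVb].
  have [P [_ [PB|PA]] VP] := refD _ DV; last exact: PA (VP _ Vx) Ax.
  suff : (closure P `&` B) b by rewrite PB.
  by split=> //; apply: closureS clVb.
have nb : nbhs b (N `&` ~` \bigcup_(V in F) closure V).
  by apply: filterI => //; apply: open_nbhs_nbhs; split=> //; exact: closed_openC.
have [y [[V [DV VA] Vy] [Ny nFy]]] := clb _ nb.
apply: nFy; exists V; last exact: subset_closure.
by split=> //; split=> //; exists y.
Qed.

Lemma paracompact_normal (R : realType) (X : topologicalType) :
  hausdorff_space X -> paracompact X -> normal_space X.
Proof.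
move=> hX pX; apply/(@normal_openP R) => A B clA clB AB0.
have disjoint_closure (P W : set X) (x : X) : open W -> W x -> P `&` W = set0 ->
    ~ closure P x.
  move=> oW Wx PW0 /(_ W (open_nbhs_nbhs (conj oW Wx))) [y].
  by rewrite PW0.
have [|W [oW BW WA]] := paracompact_separation pX clB (B := A).
  move=> b Bb; have [|W [oW AW Wb]] := paracompact_separation pX clA (B := [set b]).
    move=> x Ax; have xb : x != b.
      by apply/eqP => xb; suff : (A `&` B) x by [rewrite AB0]; split=> //; rewrite xb.
    move: hX; rewrite open_hausdorff => /(_ _ _ xb)[[P Q]] /=.
    rewrite !inE => -[Px Qb] [oP oQ PQ0]; exists P; split=> //.
    apply/seteqP; split=> // z [clz] zb; move: clz; rewrite zb.
    exact: disjoint_closure oQ Qb PQ0.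
  exists (~` closure W); split.
  - exact/closed_openC/closed_closure.
  - by move=> clb; suff : (closure W `&` [set b]) b by [rewrite Wb]; split.
  apply/seteqP; split=> // z [clz Az]; apply: disjoint_closure oW (AW _ Az) _ clz.
  by apply/disjoints_subset/subsetC/subset_closure.
exists (~` closure W), W; split=> //.
- exact/closed_openC/closed_closure.
- by move=> x Ax clx; suff : (closure W `&` A) x by [rewrite WA]; split.
by apply/disjoints_subset/subsetC/subset_closure.
Qed.

Lemma normal_shrinking (R : realType) (X : topologicalType) (I : eqType)
    (s : seq I) (U : I -> set X) (K : set X) :
  normal_space X -> (forall i, open (U i)) -> closed K ->
  K `<=` \bigcup_(i in [set` s]) U i ->
  exists A : I -> set X, [/\ forall i, closed (A i), forall i, A i `<=` U i &
    K `<=` \bigcup_(i in [set` s]) A i].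
Proof.
move=> + oU; rewrite (@normal_openP R) => nX; elim: s K => [|i s IH] K clK covK.
  exists (fun=> set0); split=> [i|i y []|x Kx]; first exact: closed0.
  by have [] := covK x Kx.
pose W := \bigcup_(j in [set` s]) U j.
have oW : open W by apply: bigcup_open => j _; exact: oU.
have [|G [H [oG oH KG KH GH]]] :=
    nX (K `&` ~` U i) (K `&` ~` W) (closedI clK (open_closedC (oU i)))
      (closedI clK (open_closedC oW)).
  apply/seteqP; split=> // x [[Kx nUx] [_ nWx]].
  have [j] := covK x Kx; rewrite /= inE => /orP[/eqP->//|js] Ujx.
  by apply: nWx; exists j.
have [|A [clA AU covA]] := IH (K `&` ~` H) (closedI clK (open_closedC oH)).
  by move=> x [Kx nHx]; apply: contrapT => nWx; apply: nHx; apply: KH.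
exists (fun j => if j == i then A i `|` (K `&` ~` G) else A j); split=> [j|j|x Kx].
- case: eqP => // _; apply: closedU => //; exact: closedI clK (open_closedC oG).
- case: eqP => [->|_]; last exact: AU.
  move=> x [/AU//|[Kx nGx]]; apply: contrapT => nUx; exact/nGx/KG.
have [Gx|nGx] := pselect (G x); last first.
  by exists i; rewrite /= ?mem_head// eqxx; right.
have [|j js Ajx] := covA x.
  by split=> // Hx; suff : (G `&` H) x by [rewrite GH]; split.
exists j; first by rewrite /= inE; apply/orP; right.
by case: eqP => [<-|//]; left.
Qed.

Lemma normal_bump (R : realType) (X : topologicalType) (A U : set X) :
  normal_space X -> closed A -> open U -> A `<=` U ->
  exists f : X -> R, [/\ continuous f, forall x, A x -> f x = 1 &
    forall x, f x != 0 -> U x].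
Proof.
rewrite (@normal_separatorP R) => nX clA oU AU.
have /(uniform_separatorP (R := R))[f [cf _ f0 f1]] :=
  nX (~` U) A (open_closedC oU) clA
    (iffRL (disjoints_subset _ _) (subsetC AU)).
exists f; split=> // [x Ax|x fx]; first by apply: f1; exists x.
by apply: contrapT => nUx; case/eqP: fx; apply: f0; exists x.
Qed.

Lemma least_le (P : set nat) m : P m -> exists2 k, least P = Some k & (k <= m)%N.
Proof.
case E: (least P) => [k|] Pm; last by move/least_NoneP: E Pm => ->.
by exists k => //; move/least_SomeP: E => [_ /(_ m Pm)].
Qed.

Lemma secat_le (E B : topologicalType) (pi : E -> B) N (U : nat -> set B) :
  (forall i, open (U i)) -> (forall i, has_local_section pi (U i)) ->
  (forall b, exists2 i, (i < N)%N & U i b) ->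
  exists2 s, secat pi = Some s & (s <= N)%N.
Proof.
move=> oU secU covU.
have leC : [set U i | i in `I_N] #<= `I_N by exact: card_image_le.
have /finite_setP[m Cm] : finite_set [set U i | i in `I_N].
  by apply/finite_set_leP; exists N.
have mN : (m <= N)%N.
  by rewrite -card_le_II; apply: card_le_trans leC; have /card_eqPle[] := Cm.
rewrite /secat; set P := (X in least X); have [|s -> sm] := @least_le P m.
  exists [set U i | i in `I_N]; split=> // [_ [i _ <-] //||_ [i _ <-] //].
  apply/seteqP; split=> // b _; have [i iN Ub] := covU b.
  by exists (U i) => //; exists i.
by exists s => //; apply: leq_trans mN.
Qed.

Section Slices.
Variables (gT : finGroupType) (X : topologicalType) (a : left_action gT X).
Local Notation pi := (orbit_map a).

Lemma orbit_mapP x y : pi x = pi y <-> exists g, a g x = y.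
Proof.
split=> [/eqmodP/existsP[g /eqP]|[g axy]]; first by exists g.
by apply/eqmodP/existsP; exists g; apply/eqP.
Qed.

Lemma orbit_map_surj u : exists x, pi x = u.
Proof. by exists (generic_quotient.repr u); exact: generic_quotient.reprK. Qed.

Lemma orbit_map_open V :
  (forall g, continuous (a g)) -> open V -> open (pi @` V).
Proof.
move=> ca oV; change (open (pi @^-1` (pi @` V))).
have -> : pi @^-1` (pi @` V) = \bigcup_(g in setT) a g @^-1` V.
  apply/seteqP; split=> [x [y Vy /esym/orbit_mapP[g axy]]|x [g _ Vax]].
    by exists g => //=; rewrite axy.
  by exists (a g x) => //; apply/esym/orbit_mapP; exists g.
by apply: bigcup_open => g _; move/continuousP: (ca g); apply.
Qed.

Definition slice (V : set X) :=
  open V /\ forall g x, V x -> V (a g x) -> g = 1%g.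

Lemma slice_has_local_section V :
  (forall g, continuous (a g)) -> slice V -> has_local_section pi (pi @` V).
Proof.
move=> ca [oV V1].
have sP (u : (pi @` V)) : exists x, V x /\ pi x = set_val u.
  by have [x Vx xu] := set_valP u; exists x.
pose s u := projT1 (cid (sP u)).
have sV u : V (s u) by have [] := projT2 (cid (sP u)).
have piE u : pi (s u) = set_val u by have [] := projT2 (cid (sP u)).
exists s; split=> //; apply/continuousP => W oW.
exists (pi @` (V `&` W)); first exact: orbit_map_open ca (openI oV oW).
apply/seteqP; split=> u /=; last first.
  by move=> Wsu; exists (s u); [split|exact: piE].
move=> [x [Vx Wx]]; rewrite -piE => /orbit_mapP[g ax].
suff -> : s u = x by [].
by rewrite -ax (V1 g x Vx) ?left_act1// ax.
Qed.

Lemma local_section_slice U : free_Gspace a -> open U ->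
  has_local_section pi U ->
  exists2 V, slice V & forall x, U (pi x) -> exists g, V (a g x).
Proof.
move=> [hX ca a1] oU [s [cs sE]].
exists (range s); last first.
  move=> x Ux; pose u : U := SigSub (mem_set Ux).
  have /esym/orbit_mapP[g ax] : pi (s u) = pi x by rewrite sE.
  by exists g; exists u.
split=> [|g _ [u _ <-] [u' _]]; last first.
  move=> su'; suff uu' : u = u' by apply: (a1 g (s u)); rewrite -su' uu'.
  apply: val_inj; rewrite -!set_valE -!sE; apply/orbit_mapP; exists g.
  by rewrite su'.
rewrite openE => _ [u0 _ <-].
have pi_s (Y : set (orbit_space a)) : open Y -> Y (set_val u0) ->
    \forall x \near s u0, Y (pi x).
  move=> oY Yu; rewrite -(sE u0) in Yu.
  by apply: open_nbhs_nbhs; split=> //; exact: oY.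
have near_ne : \forall x \near s u0, forall g, g != 1%g ->
    forall u : U, set_val u = pi x -> s u <> a g x.
  apply: filter_forall => g; have [_|g1] := eqVneq g 1%g; first by near=> x.
  have ax : s u0 != a g (s u0).
    by apply/eqP => ax; case/eqP: g1; apply: (a1 g (s u0)).
  move: hX; rewrite open_hausdorff => /(_ _ _ ax)[[P Q]] /=.
  rewrite !inE => -[Px Qx] [oP oQ PQ0].
  move/continuousP: cs => /(_ P oP)[Y oY YP].
  have Yu0 : Y (set_val u0) by rewrite -[Y _]/((set_val @^-1` Y) u0) YP.
  have Qs : \forall x \near s u0, Q (a g x).
    by apply: (ca g); exact: open_nbhs_nbhs.
  near=> x => _ u ux su; have : (P `&` Q) (s u); last by rewrite PQ0.
  split; last by rewrite su; near: x.
  rewrite -[P _]/((s @^-1` P) u) -YP /= ux; near: x; exact: pi_s.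
near=> x; have Ux : U (pi x) by near: x; apply: pi_s => //; exact: set_valP.
pose u : U := SigSub (mem_set Ux); exists u => //.
have /esym/orbit_mapP[g ax] : pi (s u) = pi x by rewrite sE.
have [g1|g1] := eqVneq g 1%g; first by rewrite -ax g1 left_act1.
by exfalso; apply: (near near_ne x _ g g1 u).
Unshelve. all: by end_near. Qed.
End Slices.

Lemma continuous_ptws (X Y : topologicalType) (I : Type)
    (f : X -> {ptws I -> Y}) :
  (forall i, continuous (fun x => f x i)) -> continuous f.
Proof.
move=> cf x; apply/cvg_sup => i U [_ [[W oW <-] Wfx]] /filterS; apply.
by apply: (cf i x); apply: open_nbhs_nbhs.
Qed.

Lemma continuous_mx (X Y : topologicalType) m n (f : X -> 'M[Y]_(m, n)) :
  (forall i j, continuous (fun x => f x i j)) -> continuous f.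
Proof.
move=> cf x A [P nP PA].
have : \forall y \near x, forall i j, P i j (f y i j).
  by apply: filter_forall => i; apply: filter_forall => j; apply: cf.
by apply: filterS => y Py; apply: PA.
Qed.

Lemma conf_mapP (gT : finGroupType) (l q : nat) (e : enumeration gT l)
    (X Y : topologicalType) (a : left_action gT X) :
  (forall g, continuous (a g)) ->
  (exists f : X -> conf Y l q,
     continuous f /\ equivariant a (conf_action Y q e) f) <->
  (exists2 phi : X -> Y, continuous phi & forall x (u : 'I_q -> gT),
     injective u -> exists r s, phi (a (u r) x) <> phi (a (u s) x)).
Proof.
move=> ca; split=> [[f [cf fa]]|[phi cphi phiP]].
  have phiE g x : set_val (f (a g x)) (enum_idx e 1%g) =
      set_val (f x) (enum_idx e g^-1%g).
    by rewrite fa set_valE /= /conf_act_fun enum_idxK mulg1.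
  exists (fun x => set_val (f x) (enum_idx e 1%g)) => [x|x u u_inj].
    apply: (@continuous_comp _ _ _ f
      (fun y : conf Y l q => set_val y (enum_idx e 1%g))).
      exact: cf.
    apply: (@continuous_comp _ _ _ set_val
      (fun y : {ptws 'I_l -> Y} => y (enum_idx e 1%g))).
      exact: initial_continuous.
    exact: proj_continuous.
  have [|r [s rs]] := conf_inj (i := fun r => enum_idx e (u r)^-1%g) (set_valP (f x)).
    by move=> r s /(can_inj (enum_idxK e))/invg_inj/u_inj.
  by exists r, s; rewrite !phiE.
pose f0 x : {ptws 'I_l -> Y} := fun j => phi (a (enum_elt e j)^-1%g x).
have f0P x : f0 x \in conf Y l q.
  apply/mem_set => i i_incr; apply: phiP => r s /invg_inj/(can_inj (enum_eltK e)) irs.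
  apply: val_inj; case: (ltngtP r s) => // /i_incr;
  by rewrite irs ltnn.
pose f x : conf Y l q := SigSub (f0P x).
exists f; split=> [|g x].
  apply: (@continuous_comp_initial _ _ _ set_val); apply: continuous_ptws => j x.
  by apply: continuous_comp; [exact: ca|exact: cphi].
apply: val_inj; apply/funext => j /=.
by rewrite /conf_act_fun set_valE /= /f0 enum_idxK invMg invgK left_actM.
Qed.

Lemma indP (R : realType) (gT : finGroupType) (l q : nat)
    (e : enumeration gT l) (X : topologicalType) (a : left_action gT X) n :
  (forall g, continuous (a g)) -> ind R e q a = Some n ->
  let P k := exists2 phi : X -> 'rV[R]_k.+1, continuous phi &
     forall x (u : 'I_q -> gT), injective u ->
       exists r s, phi (a (u r) x) <> phi (a (u s) x) in
  P n /\ forall k, P k -> (n <= k)%N.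
Proof.
move=> ca /least_SomeP[/(conf_mapP _ _ _ ca) Pn n_min]; split=> // k Pk.
by apply: n_min; apply/(conf_mapP _ _ _ ca).
Qed.

Section LowSlices.
Variables (p : nat) (p_prime : prime p).

Definition low_slice (R : realType) (X : topologicalType)
    (a : left_action 'Z_p X) (psi : X -> R) (k : nat) : set X :=
  [set x | exists B : {set 'Z_p}, [/\ #|B| = k, \sum_(b in B) b = 0 &
     forall b c, b \in B -> c \notin B -> psi (a b^-1%g x) < psi (a c^-1%g x)]].

Variables (R : realType) (X : topologicalType) (a : left_action 'Z_p X).
Hypothesis ca : forall g, continuous (a g).
Variable (psi : X -> R).

Lemma sum_translate (B : {set 'Z_p}) (g : 'Z_p) :
  \sum_(b in [set (g * b)%g | b in B]%SET) b = g *+ #|B| + \sum_(b in B) b.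
Proof.
rewrite big_imset/=; last by move=> b c _ _; apply: mulgI.
by rewrite -sumr_const -big_split.
Qed.

Lemma natr_Zp_unit (k : nat) : (0 < k < p)%N -> (k%:R : 'Z_p) \is a GRing.unit.
Proof.
move=> /andP[k0 kp]; rewrite unitZpE ?prime_gt1// prime_coprime//.
by rewrite gtnNdvd.
Qed.

Lemma low_slice_slice k : continuous psi -> (0 < k < p)%N ->
  slice a (low_slice a psi k).
Proof.
move=> cpsi kp; split; last first.
  move=> g x [B [Bk B0 ltB]] [B' [B'k B'0 ltB']].
  have BE : [set (g * b)%g | b in B]%SET = B'.
    apply/eqP; rewrite eqEcard card_imset ?Bk ?B'k ?leqnn ?andbT; last exact: mulgI.
    apply/fintype.subsetP => _ /imsetP[b bB ->]; apply: contrapT => /negP gbB'.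
    have /fintype.subsetPn[c cB' cB] : ~~ (B' \subset [set (g * b)%g | b in B]%SET).
      apply/negP => sB'; case/negP: gbB'.
      suff -> : B' = [set (g * b)%g | b in B]%SET by exact: imset_f.
      apply/eqP; rewrite eqEcard sB' card_imset ?Bk ?B'k ?leqnn//; exact: mulgI.
    have := ltB' _ _ cB' gbB'; rewrite -!left_actM invMg mulgKV ltNge => /negP; apply.
    have -> : (c^-1 * g)%g = (g^-1 * c)^-1%g by rewrite invMg invgK.
    apply/ltW/ltB => //; apply: contra cB => cB; apply/imsetP.
    by exists (g^-1 * c)%g; [exact: cB|rewrite mulKVg].
  have : g *+ k = 0.
    by have := sum_translate B g; rewrite BE B0 B'0 Bk addr0 => <-.
  rewrite -mulr_natr => /(congr1 (fun z => z / k%:R)).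
  by rewrite mulrK ?natr_Zp_unit// mul0r.
rewrite openE => x [B [Bk B0 ltB]].
have : \forall y \near x, forall b c, b \in B -> c \notin B ->
    psi (a b^-1%g y) < psi (a c^-1%g y).
  apply: filter_forall => b; apply: filter_forall => c.
  have [bB|nbB] := boolP (b \in B); last exact: nearW.
  have [cB|cB] := boolP (c \in B); first exact: nearW.
  have psi_cvg g : psi (a g y) @[y --> x] --> psi (a g x).
    by apply: (@continuous_comp _ _ _ (a g) psi); [exact: ca|exact: cpsi].
  have := ltB b c bB cB.
  rewrite -subr_gt0 => /(cvgr_gt _ (cvgB (psi_cvg c^-1%g) (psi_cvg b^-1%g))).
  by apply: filterS => y + _ _; rewrite subr_gt0.
by apply: filterS => y ltBy; exists B.
Qed.

Lemma low_slice_cover x (B : {set 'Z_p}) : (0 < #|B| < p)%N ->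
  (forall b c, b \in B -> c \notin B -> psi (a b^-1%g x) < psi (a c^-1%g x)) ->
  exists g, low_slice a psi #|B| (a g x).
Proof.
move=> Bp ltB.
have [g gB] : exists g : 'Z_p, g *+ #|B| + \sum_(b in B) b = 0.
  exists (- ((\sum_(b in B) b) / #|B|%:R)).
  by rewrite -[X in X + _]mulr_natr mulNr divrK ?natr_Zp_unit// addNr.
exists g.
exists [set (g * b)%g | b in B]%SET; split.
- by rewrite card_imset//; apply: mulgI.
- by rewrite sum_translate.
move=> _ c /imsetP[b bB ->] cB; rewrite -!left_actM invMg mulgKV.
rewrite -[(c^-1 * g)%g]invgK invMg invgK; apply: ltB => //.
apply: contra cB => cB; apply/imsetP; exists (g^-1 * c)%g; first exact: cB.
by rewrite mulKVg.
Qed.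
End LowSlices.

Lemma secat_upper (R : realType) (p q n : nat) (X : topologicalType)
    (a : left_action 'Z_p X) (phi : X -> 'rV[R]_n.+1) :
  prime p -> (0 < q <= p)%N -> (forall g, continuous (a g)) -> continuous phi ->
  (forall x (u : 'I_q -> 'Z_p), injective u ->
     exists r s, phi (a (u r) x) <> phi (a (u s) x)) ->
  exists2 s, secat (orbit_map a) = Some s & (s <= n * p.-1 + q.-1)%N.
Proof.
move=> p_prime /andP[q0 qp] ca cphi phiP.
have p1 : (0 < p.-1)%N by rewrite -ltnS prednK ?prime_gt0 ?prime_gt1.
have cardZ : #|'Z_p| = p by rewrite card_ord Zp_cast ?prime_gt1.
pose psi c x := phi x ord0 c.
pose V i := low_slice a (psi (inord (i %/ p.-1))) (i %% p.-1).+1.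
have slV i : slice a (V i).
  apply: low_slice_slice => //; last by rewrite -ltn_predRL ltn_pmod.
  move=> x; apply: (@continuous_comp _ _ _ phi (fun M : 'rV[R]_n.+1 => M ord0 _)).
    exact: cphi.
  exact: coord_continuous.
apply: (@secat_le _ _ _ _ (fun i => orbit_map a @` V i)) => [i|i|y].
- by apply: orbit_map_open => //; case: (slV i).
- exact: slice_has_local_section.
have [x <-] := orbit_map_surj y.
suff [i iN [g Vgx]] : exists2 i, (i < n * p.-1 + q.-1)%N & exists g, V i (a g x).
  exists i => //; exists (a g x) => //; apply/esym/orbit_mapP; by exists g.
pose B c := [set b : 'Z_p | [forall g, psi c (a b^-1%g x) <= psi c (a g^-1%g x)]]%SET.
have BP c b g : b \in B c -> psi c (a b^-1%g x) <= psi c (a g^-1%g x).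
  by rewrite inE => /forallP.
have B0 c : (0 < #|B c|)%N.
  apply/card_gt0P.
  have [b _ b_min] :=
    arg_minP (fun g => psi c (a g^-1%g x)) (isT : predT (0 : 'Z_p)).
  by exists b; rewrite inE; apply/forallP => g; exact: b_min.
have B_lt c b d : b \in B c -> d \notin B c ->
    psi c (a b^-1%g x) < psi c (a d^-1%g x).
  move=> bB; rewrite inE negb_forall => /existsP[g]; rewrite -ltNge.
  exact/le_lt_trans/BP.
have VB (c : 'I_n.+1) : (#|B c| < p)%N ->
    exists g, V (c * p.-1 + #|B c|.-1)%N (a g x).
  move=> Bp; have Bp' : (#|B c|.-1 < p.-1)%N.
    by rewrite ltn_predRL prednK.
  rewrite /V divnMDl// modnMDl divn_small// addn0 modn_small// prednK// inord_val.
  by apply: low_slice_cover => //; [rewrite B0|exact: B_lt].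
have [/existsP[c /andP[cn Bp]]|] := boolP [exists c : 'I_n.+1, (c < n) && (#|B c| < p)]%N.
  exists (c * p.-1 + #|B c|.-1)%N; last exact: VB.
  apply: (@leq_trans (c.+1 * p.-1)); last first.
    by apply: (@leq_trans (n * p.-1)); [rewrite leq_mul2r cn orbT|exact: leq_addr].
  by rewrite mulSn addnC ltn_add2r ltn_predRL prednK.
rewrite negb_exists => /forallP B_full.
have Bq : (#|B ord_max| < q)%N.
  rewrite ltnNge; apply/negP => qB.
  pose v (r : 'I_q) := (enum_val (widen_ord qB r))^-1%g.
  have [|r [s]] := phiP x v; first by move=> r s /invg_inj/enum_val_inj [] /val_inj.
  apply; apply/rowP => c.
  have BT t : enum_val (widen_ord qB t) \in B c.
    have [->|cn] := eqVneq c ord_max; first exact: enum_valP.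
    have /setP-> : B c = [set: 'Z_p]%SET; last by rewrite inE.
    apply/eqP; rewrite eqEcard finset.subsetT /= cardsT cardZ.
    have := B_full c; rewrite negb_and -!leqNgt => /orP[nc|//].
    by case/eqP: cn; apply/val_inj/eqP; rewrite eqn_leq nc -ltnS ltn_ord.
  by apply/eqP; rewrite eq_le !BP.
exists ((ord_max : 'I_n.+1) * p.-1 + #|B ord_max|.-1)%N; last exact: VB (leq_trans Bq qp).
by rewrite ltn_add2l ltn_predRL prednK.
Qed.

Lemma equivariant_bumps (R : realType) (gT : finGroupType)
    (X : topologicalType) (a : left_action gT X) (s : nat) (V : nat -> set X) :
  normal_space X -> (forall g, continuous (a g)) -> (forall i, open (V i)) ->
  (forall x, exists i g, (i < s)%N /\ V i (a g x)) ->
  exists theta : nat -> X -> R, [/\ forall i, continuous (theta i),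
    forall i x, theta i x != 0 -> V i x &
    forall x, exists i g, (i < s)%N /\ theta i (a g x) != 0].
Proof.
move=> nX ca oV covV.
pose igs := [seq (i, g) | i <- iota 0 s, g <- enum gT].
have oW (ig : nat * gT) : open (a ig.2 @^-1` V ig.1).
  by move/continuousP: (ca ig.2); apply.
have [|A [clA AW covA]] := normal_shrinking R (s := igs) nX oW closedT.
  move=> x _; have [i [g [i_s Vx]]] := covV x; exists (i, g) => //=.
  by apply/allpairsP; exists (i, g); rewrite mem_iota mem_enum.
pose D i := \bigcup_(g in [set: gT]) a g^-1%g @^-1` A (i, g).
have /choice[theta thetaP] i : exists f : X -> R,
    [/\ continuous f, forall x, D i x -> f x = 1 & forall x, f x != 0 -> V i x].
  apply: normal_bump => //.
    apply: closed_bigcup => [|g _]; first exact: finite_finset.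
    by move/continuous_closedP: (ca g^-1%g); apply.
  by move=> x [g _ /AW] /=; rewrite -left_actM mulgV left_act1.
exists theta; split=> [i|i|x]; [by case: (thetaP i)|by case: (thetaP i)|].
have [[i g] /allpairsP[[i' g'] /= [+ _ [-> ->]]] Ax] := covA x I.
rewrite mem_iota => i_s; exists i', g'; split=> //.
have [_ theta1 _] := thetaP i'; rewrite theta1 ?oner_neq0//.
by exists g' => //=; rewrite -left_actM mulVg left_act1.
Qed.

Lemma continuous_sum (R : realType) (X : topologicalType) (I : Type)
    (r : seq I) (F : I -> X -> R) :
  (forall i, continuous (F i)) -> continuous (fun x => \sum_(i <- r) F i x).
Proof.
move=> cF; elim: r => [|i r IH] x.
  by under eq_fun do rewrite big_nil; exact: cvg_cst.
by under eq_fun do rewrite big_cons; apply: cvgD; [exact: cF|exact: IH].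
Qed.

Lemma generic_map (R : realType) (gT : finGroupType) (X : topologicalType)
    (a : left_action gT X) (s k m : nat) (V : nat -> set X) :
  normal_space X -> (forall g, continuous (a g)) -> (forall i, slice a (V i)) ->
  (forall x, exists i g, (i < s)%N /\ V i (a g x)) -> (s <= k.+1 * m)%N ->
  exists2 phi : X -> 'rV[R]_k.+1, continuous phi &
    forall x (u : 'I_m.+1 -> gT), injective u ->
      exists r r', phi (a (u r) x) <> phi (a (u r') x).
Proof.
move=> nX ca slV covV s_le.
have [|theta [ctheta thetaV theta0]] := equivariant_bumps R nX ca _ covV.
  by move=> i; case: (slV i).
have [h hP] := exists_generic R gT m.
pose phi x : 'rV[R]_k.+1 := \row_c \sum_(j < m) \sum_g
  theta (c * m + j)%N (a g^-1%g x) * h j g.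
exists phi.
  apply: continuous_mx => i c.
  under [X in continuous X]eq_fun do rewrite mxE.
  apply: continuous_sum => j; apply: continuous_sum => g x.
  apply: cvgM; last exact: cvg_cst.
  by apply: (@continuous_comp _ _ _ (a g^-1%g)); [exact: ca|exact: ctheta].
move=> x u u_inj; apply: contrapT => /forallNP eq_phi.
pose t i := odflt 1%g [pick g | theta i (a g^-1%g x) != 0].
have t_uniq i g : theta i (a g^-1%g x) != 0 -> g = t i.
  rewrite /t; case: pickP => [g' /= + th|/(_ g) ->//].
  move=> /thetaV Vg'; have [_ V1] := slV i.
  have /V1 := thetaV _ _ th => /(_ (g'^-1 * g)%g).
  rewrite -left_actM mulgK => /(_ Vg') /(canRL (mulKVg _)).
  by rewrite mulg1.
pose rho i := theta i (a (t i)^-1%g x).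
have phiE c v : phi (a v x) ord0 c =
    \sum_(j < m) rho (c * m + j)%N * h j (v * t (c * m + j)%N)%g.
  rewrite mxE; apply: eq_bigr => j _; rewrite (reindex_inj (mulgI v)).
  rewrite (bigD1 (t (c * m + j)%N))//= big1 ?addr0 => [|g].
    by rewrite -left_actM invMg mulgKV.
  apply: contraNeq; rewrite -left_actM invMg mulgKV mulf_eq0 negb_or.
  by move=> /andP[/t_uniq -> _].
have [i [g [i_s /negP]]] := theta0 x; apply.
have m0 : (0 < m)%N by case: (m) s_le i_s => //; rewrite muln0 leqn0 => /eqP->.
have ck : (i %/ m < k.+1)%N by rewrite ltn_divLR//; apply: leq_trans s_le.
have rho0 : rho i = 0.
  pose c := Ordinal ck; pose j := Ordinal (ltn_pmod i m0).
  have iE : (c * m + j = i)%N by rewrite /= -divn_eq.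
  rewrite -iE.
  apply: (hP u (fun j => t (c * m + j)%N) (fun j => rho (c * m + j)%N)
    (phi (a (u ord0) x) ord0 c)) => // r.
  rewrite -phiE; congr (fun_of_matrix _ _ _).
  by apply: contrapT => ne; apply: (eq_phi r); exists ord0.
move: rho0; rewrite /rho /t; case: pickP => [g' /negPf + /eqP|/(_ g^-1%g)]; first by move=> ->.
by rewrite invgK => /negbFE.
Qed.

Lemma slices_of_secat (gT : finGroupType) (X : topologicalType)
    (a : left_action gT X) (s : nat) :
  free_Gspace a -> secat (orbit_map a) = Some s ->
  exists V : nat -> set X, (forall i, slice a (V i)) /\
    forall x, exists i g, (i < s)%N /\ V i (a g x).
Proof.
move=> freeX /least_SomeP[[C [C_s oC covC secC]] _].
have /card_set_bijP[U [UC _ CU]] : `I_s #= C by rewrite card_eq_sym.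
have sl0 : slice a set0 by split; [exact: open0|].
have /choice[V VP] i : exists V, slice a V /\ ((i < s)%N ->
    forall x, U i (orbit_map a x) -> exists g, V (a g x)).
  have [i_s|_] := ltnP i s; last by exists set0.
  have CUi : C (U i) by apply: UC.
  have [V sV VP] := local_section_slice freeX (oC _ CUi) (secC _ CUi).
  by exists V.
exists V; split=> [i|x]; first by have [] := VP i.
have : (\bigcup_(W in C) W) (orbit_map a x) by rewrite covC.
move=> [W /CU[i i_s <-] Ux]; have [_ /(_ i_s x Ux)[g Vg]] := VP i.
by exists i, g.
Qed.

Theorem theorem3p17 (R : realType) (p q : nat) (e : enumeration 'Z_p p)
    (X : topologicalType) (a : left_action 'Z_p X) (n : nat)
    (p_prime : prime p) (q_bounds : (2 <= q <= p)%N)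
    (X_nonempty : [set: X] !=set0) (X_paracompact : paracompact X)
    (X_free : free_Gspace a) (n_ind : ind R e q a = Some n) :
  (exists2 s : nat, secat (orbit_map a) = Some s &
     (n * (q - 1) + 1 <= s <= n * (p - 1) + q - 1)%N) /\
  (exists2 j : nat, (j <= n * (p - q) + q - 2)%N &
     secat (orbit_map a) = Some (n * (q - 1) + 1 + j)%N).
Proof.
case: q e q_bounds n_ind => [|m] // e /andP[m_gt0 m_le] n_ind.
have [hX ca _] := X_free; have [[phi cphi phiP] n_min] := indP ca n_ind.
have [|s secat_s s_le] := secat_upper p_prime _ ca cphi phiP; first by rewrite m_le.
have [V [slV covV]] := slices_of_secat X_free secat_s.
have s_gt0 : (0 < s)%N.
  have [x _] := X_nonempty; have [i [g [i_s _]]] := covV x.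
  exact: leq_ltn_trans i_s.
have n_le : (n <= s.-1 %/ m)%N.
  apply/n_min/(generic_map R (paracompact_normal R hX X_paracompact) ca slV covV).
  by rewrite -[X in (X <= _)%N](prednK s_gt0) ltn_ceil.
have s_ge : (n * m + 1 <= s)%N.
  by rewrite addn1 -[s](prednK s_gt0) ltnS -leq_divRL.
have p1E : p.-1 = (m + (p - m.+1))%N by rewrite -{1}(subnKC m_le).
rewrite p1E mulnDr /= in s_le.
split; [exists s => //|exists (s - (n * m + 1))%N].
- by rewrite !subn1 s_ge p1E mulnDr addnS.
- rewrite leq_subLR; move: s_le; case: (m) m_gt0 => //= m' _.
  by rewrite subn2 /= -addnA addn1 !addnS.
- by rewrite subn1 subnKC.
Qed.
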